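(* Let $K$ be a complete discretely valued field with ring of integers $\mathcal{O}_K$, uniformiser $\pi$ and residue field $\mathbb{F}$. Let $G$ be a compact group and $\rho\colon G\to\mathrm{GL}(V)$ a continuous irreducible representation on a finite-dimensional $K$-vector space $V$. Write $\overline{\rho}^{ss}=\bigoplus_{i=1}^rW_i^{m_i}$ with the $W_i$ pairwise non-isomorphic irreducible representations of $G$ over $\mathbb{F}$. Let $1\le i,j\le r$ with $m_i=m_j=1$. Then, up to equivalence, $\rho$ realises at most one non-split extension of $W_i$ by $W_j$.
   Context: A lattice in $V$ is a free $\mathcal{O}_K$-submodule of rank $\dim_KV$; it is stable if $\rho(g)\Lambda=\Lambda$ for all $g\in G$. The semisimplification $\overline\rho^{ss}$ of $\Lambda/\pi\Lambda$ is independent of the stable lattice $\Lambda$. A (non-split) extension of $W_i$ by $W_j$ is a triple $[U,f,g]$ where $0\to W_j\xrightarrow{f}U\xrightarrow{g}W_i\to 0$ is a (non-split) short exact sequence of $\mathbb{F}[G]$-modules. $\rho$ realises $[U,f,g]$ if there exist a stable lattice $\Lambda$ and subrepresentations $U_0\subseteq U_1\subseteq\Lambda/\pi\Lambda$ such that $U_1/U_0$ fits into a short exact sequence $0\to W_j\to U_1/U_0\to W_i\to 0$ defining the class $[U,f,g]$. Two extensions $[U,f,g]$ and $[U',f',g']$ are equivalent if $U\cong U'$ and there exist $\varphi\in\mathrm{Aut}_G(W_i)$, $\psi\in\mathrm{Aut}_G(W_j)$ with $f=f'\circ\varphi$ and $g=\psi\circ g'$. *)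

(* Defs.v *)
From HB Require Import structures.
From mathcomp Require Import all_boot all_order all_algebra.
From mathcomp Require Import all_classical all_reals all_analysis.

Set Implicit Arguments.
Unset Strict Implicit.
Unset Printing Implicit Defensive.

Import Order.TTheory GRing.Theory Num.Theory.

Local Open Scope classical_set_scope.
Local Open Scope ring_scope.

(* The valuation is normalised: its value group is the whole of Z, and
   v 0 = +oo.  The axiom valuation_entourage says that the uniform structure
   carried by K is the one defined by the valuation. *)
HB.mixin Record Uniform_isCompleteDV K
    of GRing.Field K & Uniform K := {
  valuation : K -> \bar int ;
  valuation_eqy : forall x, valuation x = +oo%E <-> x = 0 ;
  valuationM : forall x y, valuation (x * y) = (valuation x + valuation y)%E ;
  valuationD : forall x y,
    (Order.min (valuation x) (valuation y) <= valuation (x + y)%R)%E ;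
  valuation_surj : exists x, valuation x = 1%:E ;
  valuation_entourage : forall A : set (K * K), entourage A <->
    exists n : int, [set xy | (n%:E <= valuation (xy.1 - xy.2)%R)%E] `<=` A ;
  valuation_complete : forall F : set_system K,
    ProperFilter F -> cauchy F -> exists l : K, F --> l
}.

#[short(type="completeDVFieldType")]
HB.structure Definition CompleteDVField :=
  {K of GRing.Field K & Uniform K & Uniform_isCompleteDV K}.

Section ValuationRing.
Variable K : completeDVFieldType.

Definition integer_pred : {pred K} := fun x => (0 <= valuation x)%E.

Lemma valuation1 : valuation (1 : K) = 0%E.
Proof.
have [x vx] := @valuation_surj K.
have := valuationM x 1; rewrite mulr1 vx.
by case: (valuation 1) => [n| |] //= [/eqP]; rewrite addrC -subr_eq subrr => /eqP <-.
Qed.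

Lemma valuationN1 : valuation (-1 : K) = 0%E.
Proof.
have := valuationM (-1 : K) (-1); rewrite mulrNN mulr1 valuation1.
case: (valuation (-1)) => [n| |] //= [].
by move/esym/eqP; rewrite -mulr2n mulrn_eq0 /= => /eqP ->.
Qed.

Lemma integer_subring : subring_closed integer_pred.
Proof.
have vM (x y : K) : x \in integer_pred -> y \in integer_pred ->
    x * y \in integer_pred.
  by rewrite /integer_pred !unfold_in valuationM => x0 y0; exact: adde_ge0.
split=> //; first by rewrite /integer_pred unfold_in valuation1.
move=> x y x0 y0; have {y0} : - y \in integer_pred.
  by rewrite -mulN1r vM // /integer_pred unfold_in valuationN1.
move: x0; rewrite /integer_pred !unfold_in => x0 y0.
by apply: le_trans (valuationD _ _); rewrite le_min x0.
Qed.

HB.instance Definition _ :=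
  GRing.isSubringClosed.Build K integer_pred integer_subring.

Record integers := Integer { integer_val :> K; _ : integer_val \in integer_pred }.

HB.instance Definition _ := [isSub for integer_val].
HB.instance Definition _ := [Choice of integers by <:].
HB.instance Definition _ := [SubChoice_isSubComNzRing of integers by <:].

(* res identifies F with the quotient of O_K by its maximal ideal. *)
Definition is_residue_map (F : fieldType) (res : {rmorphism integers -> F}) :=
  (forall y, exists x, res x = y) /\
  (forall x, res x = 0 <-> (0 < valuation (x : K))%E).

Definition uniformiser (pi : K) := valuation pi = 1%:E.

End ValuationRing.

HB.mixin Record isTopologicalGroup G of Group G & Topological G := {
  mulg_continuous : continuous (fun xy : G * G => (xy.1 * xy.2)%g) ;
  invg_continuous : continuous (fun x : G => x^-1%g)
}.

#[short(type="topologicalGroupType")]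
HB.structure Definition TopologicalGroup :=
  {G of Group G & Topological G & isTopologicalGroup G}.

Section Representations.
Variables (F : fieldType) (G : groupType).

Record rep := Rep {
  rep_space :> vectType F ;
  rep_act : G -> 'End(rep_space) ;
  _ : rep_act 1%g = \1%VF ;
  _ : forall g h, rep_act (g * h)%g = (rep_act g \o rep_act h)%VF
}.

Lemma rep_act1 (M : rep) : rep_act M 1%g = \1%VF. Proof. by case: M. Qed.

Lemma rep_actM (M : rep) g h :
  rep_act M (g * h)%g = (rep_act M g \o rep_act M h)%VF.
Proof. by case: M. Qed.

Definition is_rep_hom (M N : rep) (f : 'Hom(M, N)) :=
  forall g x, f (rep_act M g x) = rep_act N g (f x).

Definition is_rep_iso (M N : rep) (f : 'Hom(M, N)) :=
  is_rep_hom f /\ bijective f.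

Definition rep_isom (M N : rep) := exists f : 'Hom(M, N), is_rep_iso f.

Definition subrep (M : rep) (U : {vspace M}) :=
  forall g, (rep_act M g @: U <= U)%VS.

Definition irreducible_rep (M : rep) :=
  (0 < \dim {:M})%N /\
  forall U : {vspace M}, subrep U -> U = 0%VS \/ U = fullv.

(* Q is the quotient representation U1 / U0, with projection the restriction
   of p to U1 (every linear map on U1 is such a restriction). *)
Definition is_subquotient (M : rep) (U0 U1 : {vspace M}) (Q : rep) :=
  exists p : 'Hom(M, Q),
    [/\ forall g x, x \in U1 -> p (rep_act M g x) = rep_act Q g (p x),
        (p @: U1)%VS = fullv
      & (U1 :&: lker p)%VS = U0].

Definition rep0_act (g : G) : 'End('rV[F]_0) := \1%VF.

Lemma rep0_act1 : rep0_act 1%g = \1%VF. Proof. by []. Qed.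

Lemma rep0_actM g h : rep0_act (g * h)%g = (rep0_act g \o rep0_act h)%VF.
Proof. by rewrite /rep0_act comp_lfun1l. Qed.

Definition rep0 : rep := Rep rep0_act1 rep0_actM.

Section DirectSum.
Variables M N : rep.

Definition dsum_fun (g : G) (x : M * N) : M * N :=
  (rep_act M g x.1, rep_act N g x.2).

Lemma dsum_fun_linear g : linear (dsum_fun g).
Proof. by move=> a x y; rewrite /dsum_fun !linearP. Qed.

HB.instance Definition _ g :=
  GRing.isLinear.Build F (M * N)%type (M * N)%type *:%R (dsum_fun g)
    (dsum_fun_linear g).

Definition dsum_act (g : G) : 'End((M * N)%type) := linfun (dsum_fun g).

Lemma dsum_act1 : dsum_act 1%g = \1%VF.
Proof.
apply/lfunP => -[x y]; rewrite lfunE /= /dsum_fun /= !rep_act1.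
by rewrite !id_lfunE.
Qed.

Lemma dsum_actM g h : dsum_act (g * h)%g = (dsum_act g \o dsum_act h)%VF.
Proof.
apply/lfunP => -[x y]; rewrite comp_lfunE !lfunE /= /dsum_fun /= !rep_actM.
by rewrite !comp_lfunE.
Qed.

Definition rep_dsum : rep := Rep dsum_act1 dsum_actM.

End DirectSum.

Definition rep_bigsum (n : nat) (W : 'I_n -> rep) : rep :=
  \big[rep_dsum/rep0]_(i < n) W i.

Definition rep_mul (W : rep) (m : nat) : rep := rep_bigsum (fun _ : 'I_m => W).

Definition is_semisimplification (M S : rep) :=
  exists (n : nat) (fil : nat -> {vspace M}) (gr : 'I_n -> rep),
    [/\ fil 0%N = 0%VS /\ fil n = fullv,
        forall k, (k <= n)%N -> subrep (fil k),
        forall k : 'I_n, (fil k <= fil k.+1)%VS,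
        forall k : 'I_n,
          is_subquotient (fil k) (fil k.+1) (gr k) /\ irreducible_rep (gr k)
      & rep_isom S (rep_bigsum gr)].

Record extension (Wi Wj : rep) := Extension {
  ext_rep :> rep ;
  ext_inj : 'Hom(Wj, ext_rep) ;
  ext_proj : 'Hom(ext_rep, Wi) ;
  ext_inj_hom : is_rep_hom ext_inj ;
  ext_proj_hom : is_rep_hom ext_proj ;
  ext_inj_injective : lker ext_inj = 0%VS ;
  ext_exact : limg ext_inj = lker ext_proj ;
  ext_proj_surjective : limg ext_proj = fullv
}.

Definition split_extension (Wi Wj : rep) (E : extension Wi Wj) :=
  exists s : 'Hom(Wi, E), is_rep_hom s /\ (ext_proj E \o s)%VF = \1%VF.

Definition same_class (Wi Wj : rep) (E E' : extension Wi Wj) :=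
  exists theta : 'Hom(E, E'),
    [/\ is_rep_iso theta,
        (theta \o ext_inj E)%VF = ext_inj E'
      & ext_proj E = (ext_proj E' \o theta)%VF].

(* theta identifies the middle terms; phi and psi act on the ends so that the
   composites make sense, i.e. on the source of ext_inj and on the target of
   ext_proj. *)
Definition equivalent_extensions (Wi Wj : rep) (E E' : extension Wi Wj) :=
  exists (theta : 'Hom(E, E')) (phi : 'End(Wj)) (psi : 'End(Wi)),
    [/\ is_rep_iso theta, is_rep_iso (phi : 'Hom(Wj, Wj)),
        is_rep_iso (psi : 'Hom(Wi, Wi)),
        (theta \o ext_inj E)%VF = (ext_inj E' \o phi)%VF
      & ext_proj E = (psi \o (ext_proj E' \o theta))%VF].

End Representations.

Section Lattices.
Variables (K : completeDVFieldType) (G : topologicalGroupType).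
Variable rho : rep K G.

(* The topology on GL(V) does not depend on the basis used to identify
   End(V) with a space of matrices. *)
Definition continuous_rep :=
  continuous (fun g : G =>
    passmx.mxof (vbasis {:rho}) (vbasis {:rho}) (rep_act rho g)).

Definition lattice (L : set rho) :=
  exists e : 'I_(\dim {:rho}) -> rho,
    (forall c : 'I_(\dim {:rho}) -> integers K,
       \sum_k (c k : K) *: e k = 0 -> forall k, c k = 0) /\
    L = [set x | exists c : 'I_(\dim {:rho}) -> integers K,
                   x = \sum_k (c k : K) *: e k].

Definition stable_lattice (L : set rho) :=
  lattice L /\ forall g, rep_act rho g @` L = L.

Variables (pi : K) (F : fieldType) (res : {rmorphism integers K -> F}).

(* M is the representation L / pi L over F, with projection the restriction
   of red to L; the values of red outside L are irrelevant. *)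
Definition is_reduction (L : set rho) (M : rep F G) :=
  exists red : rho -> M,
    [/\ (forall x y, L x -> L y -> red (x + y) = red x + red y) /\
        (forall (a : integers K) x, L x -> red ((a : K) *: x) = res a *: red x),
        (forall y, exists2 x, L x & red x = y),
        (forall x, L x -> (red x = 0 <-> exists2 y, L y & x = pi *: y))
      & (forall g x, L x -> red (rep_act rho g x) = rep_act M g (red x))].

(* The semisimplification does not depend on the stable lattice, so that it
   may be computed on any one of them. *)
Definition is_residual_ss (S : rep F G) :=
  exists (L : set rho) (M : rep F G),
    [/\ stable_lattice L, is_reduction L M & is_semisimplification M S].

Definition realises (Wi Wj : rep F G) (E : extension Wi Wj) :=
  exists (L : set rho) (M : rep F G) (U0 U1 : {vspace M}),
    [/\ stable_lattice L, is_reduction L M,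
        [/\ subrep U0, subrep U1 & (U0 <= U1)%VS]
      & exists2 E' : extension Wi Wj,
          is_subquotient U0 U1 E' & same_class E' E].

End Lattices.

(* Main.v *)
Require Import Defs.
From HB Require Import structures.
From mathcomp Require Import all_boot all_order all_algebra.
From mathcomp Require Import all_classical all_reals all_analysis.
From mathcomp Require Import zify.

(** A realised extension E of W_i by W_j is a quotient of a stable lattice D, and
    E' one of a stable lattice D'.  Scale D' so that D :&: D' maps onto W_i through
    D but D :&: pi D' does not.  If D :&: D' did not also map onto W_i through D',
    then W_i would occur twice in D' / pi D'.  Since the extensions do not split,
    D :&: D' then maps onto both E and E'; if the two kernels differed, W_j would
    occur twice in the reduction of D :&: D'.  So E and E' are quotients of
    D :&: D' by the same sublattice.

    To bound the multiplicity of an irreducible W in B / pi B for every stable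
    lattice B, pull a composition series of the reduction of one lattice L back to
    pi L = C_0 <= ... <= C_N = L and attach to B its jumps, the pairs (k, n) such
    that pi^n B :&: C_(k+1) is not contained in C_k.  If B / A is isomorphic to W,
    then B has a jump (k, n) that A has not, with C_(k+1) / C_k isomorphic to W.
    When only one k is of that type, pi B lacks at most one of the jumps (k, n)
    of B. *)

Set Implicit Arguments.
Unset Strict Implicit.
Unset Printing Implicit Defensive.

Import Order.TTheory GRing.Theory Num.Theory.

Local Open Scope classical_set_scope.
Local Open Scope ring_scope.

(** * Irreducible representations *)

(** A subspace inside [S] that misses a point of [S] can be enlarged by it, and dimensions are
    bounded. Closed predicates thus become subspaces, to which irreducibility applies. *)
Lemma vspace_of_closed (F : fieldType) (vT : vectType F) (S : vT -> Prop) :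
  S 0 -> (forall a x y, S x -> S y -> S (a *: x + y)) ->
  exists U : {vspace vT}, forall x, x \in U <-> S x.
Proof.
move=> S0 SD.
have step n : (exists U : {vspace vT}, forall x, x \in U <-> S x) \/
    exists U : {vspace vT}, (n <= \dim U)%N /\ forall x, x \in U -> S x.
  elim: n => [|n [|[U [nU US]]]]; [right | by left |].
    by exists 0%VS; split=> // x; rewrite memv0 => /eqP ->.
  have [SU|] := pselect (forall x, S x -> x \in U).
    by left; exists U => x; split; [exact: US | exact: SU].
  move=> /existsNP[x] /not_implyP[Sx /negP xU]; right.
  exists (<[x]> + U)%VS; split.
    rewrite dimv_disjoint_sum ?dim_vline; last first.
      apply/eqP; rewrite -subv0; apply/subvP => y /memv_capP[/vlineP[k ->]].
      have [->|k0] := eqVneq k 0; first by rewrite scale0r !mem0v.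
      by move=> /(memvZ k^-1); rewrite scalerA mulVf // scale1r (negPf xU).
    by have -> : x != 0; [apply: contraNneq xU => ->; exact: mem0v | rewrite add1n].
  by move=> y /memv_addP[_ /vlineP[k ->] [z /US Sz ->]]; exact: SD.
have [//|[U [/leq_trans/(_ (dimvS (subvf U)))]]] := step (\dim {:vT}).+1.
by rewrite ltnn.
Qed.

Section RepresentationTheory.
Variables (F : fieldType) (G : groupType).
Implicit Types X Y Z : rep F G.

Lemma irreducible_closed X (S : X -> Prop) x0 : irreducible_rep X ->
  (forall a x y, S x -> S y -> S (a *: x + y)) ->
  (forall g x, S x -> S (rep_act X g x)) ->
  S x0 -> x0 <> 0 -> forall x, S x.
Proof.
move=> [_ irrX] SD Sg Sx0 x00.
have S0 : S 0 by have := SD (-1) _ _ Sx0 Sx0; rewrite scaleN1r addNr.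
have [U US] := vspace_of_closed S0 SD.
have [g|U0|UT] := irrX U.
- by apply/subvP => _ /memv_imgP[x /US Sx ->]; apply/US/Sg.
- by move/US : Sx0; rewrite U0 memv0 => /eqP.
- by move=> x; apply/US; rewrite UT memvf.
Qed.

Lemma irreducible_neq0 X : irreducible_rep X -> exists x : X, x <> 0.
Proof.
move=> [X0 _]; exists (vpick {:X}) => /eqP.
by rewrite vpick0 -dimv_eq0 -leqn0 leqNgt X0.
Qed.

(** Linearity of [R] reduces single-valuedness to the fibre over 0. Induced homomorphisms are
    obtained below from their graphs in this way. *)
Lemma hom_of_graph X Y (R : X -> Y -> Prop) :
  (forall x, exists y, R x y) -> (forall y, R 0 y -> y = 0) ->
  (forall a x y x' y', R x y -> R x' y' -> R (a *: x + x') (a *: y + y')) ->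
  (forall g x y, R x y -> R (rep_act X g x) (rep_act Y g y)) ->
  exists u : 'Hom(X, Y), is_rep_hom u /\ forall x y, R x y -> u x = y.
Proof.
move=> Rtot R0 RD Rg; have [f Rf] := choice Rtot.
have fE x y : R x y -> f x = y.
  move=> Rxy; apply/eqP; rewrite -subr_eq0 -opprB oppr_eq0; apply/eqP/R0.
  by have := RD (-1) _ _ _ _ (Rf x) Rxy; rewrite !scaleN1r addNr [- _ + _]addrC.
have f_lin : linear f by move=> a x y; apply: fE; exact: RD.
pose fL : {linear X -> Y} := HB.pack f (GRing.isLinear.Build F X Y *:%R f f_lin).
have uE : linfun fL =1 f by exact: lfunE.
exists (linfun fL); split=> [g x|x y].
  by rewrite !uE; apply: fE; exact: Rg.
by rewrite uE; exact: fE.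
Qed.

Lemma bijective_lfun (aT rT : vectType F) (f : 'Hom(aT, rT)) :
  (forall x, f x = 0 -> x = 0) -> (forall y, exists x, f x = y) -> bijective f.
Proof.
move=> f0 fS; exists (f^-1)%VF.
  apply: lker0_lfunK; rewrite -subv0; apply/subvP => x.
  by rewrite memv_ker => /eqP/f0 ->; rewrite mem0v.
by move=> y; apply: limg_lfunVK; have [x <-] := fS y; rewrite memv_img ?memvf.
Qed.

(** Schur's lemma: the image is nonzero, hence everything, and the kernel is proper, hence zero. *)
Lemma irreducible_hom_iso X Y (u : 'Hom(X, Y)) :
  irreducible_rep X -> irreducible_rep Y -> is_rep_hom u -> (exists x, u x <> 0) -> is_rep_iso u.
Proof.
move=> irrX irrY uhom [x0 ux0]; split=> //; apply: bijective_lfun; last first.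
  apply: (irreducible_closed (S := fun y => exists x, u x = y) irrY) ux0.
  - by move=> a _ _ [x <-] [y <-]; exists (a *: x + y); rewrite linearP.
  - by move=> g _ [x <-]; exists (rep_act X g x); rewrite uhom.
  - by exists x0.
apply: contrapT => /existsNP[x /not_implyP[ux x_neq0]]; apply: ux0.
apply: (irreducible_closed (S := fun x => u x = 0) irrX) x_neq0 x0 => //.
- by move=> a y z uy uz; rewrite linearP /= uy uz scaler0 addr0.
- by move=> g y uy; rewrite uhom uy linear0.
Qed.

Lemma hom_comp X Y Z (u : 'Hom(Y, Z)) (v : 'Hom(X, Y)) :
  is_rep_hom u -> is_rep_hom v -> is_rep_hom (u \o v)%VF.
Proof. by move=> hu hv g x; rewrite !comp_lfunE hv hu. Qed.

Lemma iso_inv X Y (u : 'Hom(X, Y)) : is_rep_iso u ->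
  exists v : 'Hom(Y, X), [/\ is_rep_iso v, cancel u v & cancel v u].
Proof.
move=> [uhom [w uw wu]].
have [|y|a x y x' y' <- <-|g x y <-|v [vhom vE]] :=
    hom_of_graph (R := fun y x => u x = y).
- by move=> y; exists (w y); rewrite wu.
- by move=> uy; rewrite -(uw y) uy -[X in w X](linear0 u) uw.
- by rewrite linearP.
- by rewrite uhom.
have uv : cancel u v by move=> x; exact: vE.
have vu : cancel v u by move=> y; rewrite -{1}(wu y) uv wu.
by exists v; split=> //; split=> //; exists u.
Qed.

Lemma rep_isom_sym X Y : rep_isom X Y -> rep_isom Y X.
Proof. by move=> [u /iso_inv[v [viso _ _]]]; exists v. Qed.

End RepresentationTheory.

(** * Multiplicities in direct sums *)

Section Multiplicity.
Variables (F : fieldType) (G : groupType).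
Implicit Types X Y Z : rep F G.

(** [e] is the equivariant projector of [Y] onto a direct summand isomorphic to [X]. *)
Definition is_retract X Y (e : Y -> Y) :=
  exists (a : 'Hom(X, Y)) (p : 'Hom(Y, X)),
    [/\ is_rep_hom a, is_rep_hom p, cancel a p & forall y, a (p y) = e y].

Lemma retract_trans X Y Z (e : Y -> Y) (a : 'Hom(Y, Z)) (p : 'Hom(Z, Y)) :
  is_rep_hom a -> is_rep_hom p -> cancel a p ->
  is_retract X e -> is_retract X (a \o e \o p).
Proof.
move=> ahom phom ap [b [q [bhom qhom bq bqE]]].
exists (a \o b)%VF, (q \o p)%VF; split; try exact: hom_comp.
  by move=> x; rewrite !comp_lfunE ap bq.
by move=> y; rewrite /= !comp_lfunE bqE.
Qed.

Section DirectSum.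
Variables X Y : rep F G.

Let inl_fun (x : X) : rep_dsum X Y := (x, 0).
Let inr_fun (y : Y) : rep_dsum X Y := (0, y).
Let outl_fun (z : rep_dsum X Y) : X := z.1.
Let outr_fun (z : rep_dsum X Y) : Y := z.2.

Lemma dsum_retractl : exists (a : 'Hom(X, rep_dsum X Y)) (p : 'Hom(rep_dsum X Y, X)),
  [/\ is_rep_hom a, is_rep_hom p, forall x, a x = (x, 0) & forall z, p z = z.1].
Proof.
have al : linear inl_fun.
  by move=> c x y; congr pair; rewrite /= scaler0 addr0.
have pl : linear outl_fun by [].
pose aL : {linear X -> rep_dsum X Y} := HB.pack inl_fun
  (GRing.isLinear.Build F X (rep_dsum X Y) *:%R inl_fun al).
pose pL : {linear rep_dsum X Y -> X} := HB.pack outl_fun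
  (GRing.isLinear.Build F (rep_dsum X Y) X *:%R outl_fun pl).
have aE : linfun aL =1 inl_fun by exact: lfunE.
have pE : linfun pL =1 outl_fun by exact: lfunE.
exists (linfun aL), (linfun pL); split=> //.
  by move=> g x; rewrite !aE /= lfunE /= /dsum_fun /= linear0.
by move=> g z; rewrite !pE /= lfunE.
Qed.

Lemma dsum_retractr : exists (a : 'Hom(Y, rep_dsum X Y)) (p : 'Hom(rep_dsum X Y, Y)),
  [/\ is_rep_hom a, is_rep_hom p, forall y, a y = (0, y) & forall z, p z = z.2].
Proof.
have al : linear inr_fun.
  by move=> c x y; congr pair; rewrite /= scaler0 addr0.
have pl : linear outr_fun by [].
pose aL : {linear Y -> rep_dsum X Y} := HB.pack inr_fun
  (GRing.isLinear.Build F Y (rep_dsum X Y) *:%R inr_fun al).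
pose pL : {linear rep_dsum X Y -> Y} := HB.pack outr_fun
  (GRing.isLinear.Build F (rep_dsum X Y) Y *:%R outr_fun pl).
have aE : linfun aL =1 inr_fun by exact: lfunE.
have pE : linfun pL =1 outr_fun by exact: lfunE.
exists (linfun aL), (linfun pL); split=> //.
  by move=> g x; rewrite !aE /= lfunE /= /dsum_fun /= linear0.
by move=> g z; rewrite !pE /= lfunE.
Qed.

End DirectSum.

(* Working with the orthogonal projectors of a direct sum, rather than with the
   family of its injections and projections, avoids dependent types. *)
Lemma bigsum_projectors n (W : 'I_n -> rep F G) :
  exists e : 'I_n -> rep_bigsum W -> rep_bigsum W,
    [/\ forall x, x = \sum_k e k x,
        forall k l x, k <> l -> e k (e l x) = 0
      & forall k, is_retract (W k) (e k)].
Proof.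
elim: n W => [|n IH] W.
  exists (fun _ => id); split=> [x|[]//|[]//].
  rewrite big_ord0; move: x; rewrite /rep_bigsum big_ord0 => x.
  exact: thinmx0.
have [e [esum eorth eret]] := IH (fun k => W (lift ord0 k)).
rewrite /rep_bigsum big_ord_recl -/(rep_bigsum (fun k => W (lift ord0 k))).
set S := rep_bigsum _ in e esum eorth eret *.
have e0 k : e k 0 = 0.
  by have [a [p [_ _ _ <-]]] := eret k; rewrite !linear0.
pose e' (k : 'I_n.+1) (x : rep_dsum (W ord0) S) : rep_dsum (W ord0) S :=
  if unlift ord0 k is Some j then (0, e j x.2) else (x.1, 0).
have e'0 x : e' ord0 x = (x.1, 0) by rewrite /e' unlift_none.
have e'S j x : e' (lift ord0 j) x = (0, e j x.2) by rewrite /e' liftK.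
exists e'; split.
- move=> [x y]; rewrite big_ord_recl e'0 /=.
  under eq_bigr => j _ do rewrite e'S /=.
  rewrite (_ : \sum_j _ = (0, \sum_j e j y)); last first.
    apply: (big_rec2 (fun (u : rep_dsum (W ord0) S) v => u = (0, v))) => //.
    by move=> j u v _ ->; congr pair; rewrite /= addr0.
  by rewrite -esum; congr pair; rewrite /= ?addr0 ?add0r.
- move=> k l x; case: (unliftP ord0 k) => [k'|] ->;
    case: (unliftP ord0 l) => [l'|] -> kl; rewrite ?e'S ?e'0 /= ?e0 //.
  by rewrite eorth // => kl'; apply: kl; rewrite kl'.
- move=> k; case: (unliftP ord0 k) => [k'|] ->.
    have [a [p [ahom phom aE pE]]] := dsum_retractr (W ord0) S.
    have ap : cancel a p by move=> y; rewrite pE aE.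
    have [b [q [bhom qhom bq bqE]]] := retract_trans ahom phom ap (eret k').
    by exists b, q; split=> // y; rewrite bqE /= aE pE e'S.
  have [a [p [ahom phom aE pE]]] := dsum_retractl (W ord0) S.
  by exists a, p; split=> // [x|y]; rewrite ?pE aE ?pE // e'0.
Qed.

Lemma hom_mul_eq0 X Y m (u : 'Hom(X, rep_mul Y m)) :
  irreducible_rep X -> irreducible_rep Y -> ~ rep_isom X Y -> is_rep_hom u ->
  forall x, u x = 0.
Proof.
move=> irrX irrY nXY uhom x.
have [e [esum _ eret]] := bigsum_projectors (fun _ : 'I_m => Y).
rewrite [LHS]esum big1 // => k _.
have [a [p [_ phom _ <-]]] := eret k.
rewrite (_ : p (u x) = 0) ?linear0 // -comp_lfunE.
apply: contrapT => ux; apply: nXY; exists (p \o u)%VF.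
apply: irreducible_hom_iso => //.
  exact: hom_comp.
by exists x.
Qed.

(** If [k] and [l] differed, [S] would contain two independent copies of [W i], while every
    composite [W i -> S -> W i] passes through a single one. *)
Lemma multiplicity_one r (W : 'I_r -> rep F G) (m : 'I_r -> nat) n
    (gr : 'I_n -> rep F G) (i : 'I_r) (k l : 'I_n) :
  (forall i, irreducible_rep (W i)) ->
  (forall i j, i <> j -> ~ rep_isom (W i) (W j)) ->
  m i = 1%N ->
  rep_isom (rep_bigsum (fun i => rep_mul (W i) (m i))) (rep_bigsum gr) ->
  rep_isom (W i) (gr k) -> rep_isom (W i) (gr l) -> k = l.
Proof.
move=> Wirr Wniso mi Sgr Wk Wl; apply: contrapT => kl.
set S := rep_bigsum _ in Sgr.
(* [i0] and [w0] are the injection and projection of the only copy of [W i]; maps from [W i] to the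
   other isotypic summands vanish by Schur's lemma. *)
have [i0 [w0 [ihom whom iw]]] : exists (a : 'Hom(W i, S)) (p : 'Hom(S, W i)),
    [/\ is_rep_hom a, is_rep_hom p &
     forall (u : 'Hom(W i, S)) (v : 'Hom(S, W i)), is_rep_hom u ->
       is_rep_hom v -> forall x, v (u x) = v (a (p (u x)))].
  have [e [esum _ eret]] := bigsum_projectors (fun i => rep_mul (W i) (m i)).
  have [a [p [ahom phom ap apE]]] := eret i.
  have [b [q [bhom qhom bqE]]] : exists (b : 'Hom(W i, rep_mul (W i) (m i)))
      (q : 'Hom(rep_mul (W i) (m i), W i)),
      [/\ is_rep_hom b, is_rep_hom q & forall y, y = b (q y)].
    rewrite mi; have [f [fsum _ fret]] := bigsum_projectors (fun _ : 'I_1 => W i).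
    have [b [q [bhom qhom _ bqE]]] := fret ord0.
    by exists b, q; split=> // y; rewrite [LHS]fsum big_ord1 bqE.
  exists (a \o b)%VF, (q \o p)%VF; split; try exact: hom_comp.
  move=> u v uhom vhom x; rewrite !comp_lfunE -bqE apE.
  rewrite [in LHS](esum (u x)) (bigD1 i) //= big1 ?addr0 // => j /eqP ji.
  have [c [t [_ thom _ <-]]] := eret j.
  rewrite -[t (u x)]comp_lfunE (hom_mul_eq0 (u := (t \o u)%VF)) ?linear0 //.
    by apply: Wniso => ij; apply: ji.
  exact: hom_comp.
have [e [_ eorth eret]] := bigsum_projectors gr.
have [s siso] := Sgr; have [shom _] := siso.
have [t [[thom _] st ts]] := iso_inv siso.
have ret k' : rep_isom (W i) (gr k') ->
    exists (a : 'Hom(W i, S)) (p : 'Hom(S, W i)),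
    [/\ is_rep_hom a, is_rep_hom p, cancel a p,
        forall x, s (a x) = e k' (s (a x)) & forall x, p x = p (t (e k' (s x)))].
  move=> [u uiso]; have [uhom _] := uiso; have [v [[vhom _] uv vu]] := iso_inv uiso.
  have [a [p [ahom phom ap apE]]] := eret k'.
  exists (t \o (a \o u))%VF, (v \o (p \o s))%VF; split.
  - by do !apply: hom_comp.
  - by do !apply: hom_comp.
  - by move=> x; rewrite !comp_lfunE ts ap uv.
  - by move=> x; rewrite !comp_lfunE ts -apE ap.
  - by move=> x; rewrite !comp_lfunE ts -apE ap.
have [ak [pk [akhom pkhom akpk _ pkE]]] := ret k Wk.
have [al [pl [alhom plhom alpl alE _]]] := ret l Wl.
have pkal x : pk (al x) = 0 by rewrite pkE alE eorth // !linear0.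
have [x x0] := irreducible_neq0 (Wirr i).
(* Since [pk \o i0] is injective and [pk \o al] is zero, [w0 \o al] is zero; but [pl \o al] is the
   identity and factors through [w0 \o al]. *)
have : is_rep_iso (pk \o i0)%VF.
  apply: irreducible_hom_iso => //; first exact: hom_comp.
  exists (w0 (ak x)); rewrite comp_lfunE -iw // akpk.
  exact: x0.
move=> [_ /bij_inj pki_inj]; apply: x0.
rewrite -(alpl x) iw // (_ : w0 (al x) = 0) ?linear0 //.
by apply: pki_inj; rewrite comp_lfunE -iw // pkal linear0.
Qed.

End Multiplicity.

(** * Non-split extensions *)

Section Extensions.
Variables (F : fieldType) (G : groupType) (Wi Wj : rep F G).
Hypotheses (Wi_irr : irreducible_rep Wi) (Wj_irr : irreducible_rep Wj).
Implicit Types E : extension Wi Wj.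

Lemma ext_inj_eq0 E w : ext_inj E w = 0 -> w = 0.
Proof.
move=> w0; apply/eqP; rewrite -memv0 -(ext_inj_injective E) memv_ker.
exact/eqP.
Qed.

Lemma ext_projK E w : ext_proj E (ext_inj E w) = 0.
Proof. by apply/eqP; rewrite -memv_ker -ext_exact memv_img ?memvf. Qed.

Lemma ext_proj_eq0 E e : ext_proj E e = 0 -> exists w, e = ext_inj E w.
Proof.
move/eqP; rewrite -memv_ker -ext_exact => /memv_imgP[w _ ->].
by exists w.
Qed.

Lemma ext_proj_surj E w : exists e, ext_proj E e = w.
Proof.
have : w \in limg (ext_proj E) by rewrite ext_proj_surjective memvf.
by move/memv_imgP => [e _ ->]; exists e.
Qed.

Section NonSplit.
Variables (E : extension Wi Wj) (T : E -> Prop).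
Hypotheses (E_nonsplit : ~ split_extension E)
  (TD : forall a x y, T x -> T y -> T (a *: x + y))
  (Tg : forall g x, T x -> T (rep_act E g x)).

Lemma closed_ext_proj e0 : T e0 -> ext_proj E e0 <> 0 ->
  forall w, exists e, T e /\ ext_proj E e = w.
Proof.
move=> Te0 pe0; apply: irreducible_closed pe0 => //.
- move=> a _ _ [x [Tx <-]] [y [Ty <-]]; exists (a *: x + y).
  by rewrite linearP; split=> //; exact: TD.
- move=> g _ [x [Tx <-]]; exists (rep_act E g x).
  by split; [exact: Tg | rewrite ext_proj_hom].
- by exists e0.
Qed.

(** If [T] met the image of [Wj] trivially, [ext_proj E] would map [T] bijectively onto [Wi], and
    the inverse would be a splitting. *)
Lemma nonsplit_socle e0 : T e0 -> e0 <> 0 ->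
  exists w, w <> 0 /\ T (ext_inj E w).
Proof.
move=> Te0 e00; apply: contrapT => /forallNP noT.
have {}noT w : T (ext_inj E w) -> w = 0.
  by move=> Tw; apply: contrapT => w0; apply: (noT w).
have pe0 : ext_proj E e0 <> 0.
  move=> /ext_proj_eq0[w e0E]; apply: e00; rewrite e0E (noT w) ?linear0 //.
  by rewrite -e0E.
have Tsurj := closed_ext_proj Te0 pe0.
have [w|e|a w e w' e'|g w e|s [shom sE]] := hom_of_graph
    (R := fun w e => T e /\ ext_proj E e = w).
- exact: Tsurj.
- by move=> [Te /ext_proj_eq0[w eE]]; rewrite eE (noT w) ?linear0 // -eE.
- by move=> [Te <-] [Te' <-]; split; [exact: TD | rewrite linearP].
- by move=> [Te <-]; split; [exact: Tg | rewrite ext_proj_hom].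
apply: E_nonsplit; exists s; split=> //.
apply/lfunP => w; rewrite comp_lfunE id_lfunE.
by have [e Re] := Tsurj w; rewrite (sE _ _ Re); case: Re.
Qed.

(** By [nonsplit_socle] and irreducibility, [T] contains all of [Wj]; it also maps onto [Wi]. *)
Lemma nonsplit_cosocle e0 : T e0 -> ext_proj E e0 <> 0 -> forall e, T e.
Proof.
move=> Te0 pe0 e.
have Tj w : T (ext_inj E w).
  have [|w0 [w00 Tw0]] := nonsplit_socle Te0.
    by move=> e00; apply: pe0; rewrite e00 linear0.
  apply: (irreducible_closed (S := fun w => T (ext_inj E w))) w00 w => //.
    by move=> a x y Tx Ty; rewrite linearP; exact: TD.
  by move=> g x Tx; rewrite ext_inj_hom; exact: Tg.
have [e' [Te' pe']] := closed_ext_proj Te0 pe0 (ext_proj E e).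
have [|w ew] := @ext_proj_eq0 E (e - e'); first by rewrite linearB /= pe' subrr.
by rewrite -(subrK e' e) ew -[ext_inj E w]scale1r; exact: TD.
Qed.

End NonSplit.

(** An isomorphism of middle terms must respect the copies of [Wj]: otherwise [Wj -> E -> E' -> Wi]
    is an isomorphism and splits [E']. It then induces [phi] on [Wj] and [psi] on [Wi]. *)
Lemma equivalent_of_isom E E' : ~ split_extension E' ->
  rep_isom E E' -> equivalent_extensions E E'.
Proof.
move=> E'_nonsplit [th thiso]; have [thhom thbij] := thiso.
have [th' [[th'hom _] thK th'K]] := iso_inv thiso.
have pti w : ext_proj E' (th (ext_inj E w)) = 0.
  pose u := (ext_proj E' \o (th \o ext_inj E))%VF.
  have uhom : is_rep_hom u.
    by do !apply: hom_comp => //; [exact: ext_proj_hom | exact: ext_inj_hom].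
  apply: contrapT => w0.
  have uiso : is_rep_iso u.
    by apply: irreducible_hom_iso => //; exists w; rewrite !comp_lfunE.
  have [v [[vhom _] _ vu]] := iso_inv uiso.
  apply: E'_nonsplit; exists (th \o (ext_inj E \o v))%VF; split.
    by do !apply: hom_comp => //; exact: ext_inj_hom.
  by apply/lfunP => x; have := vu x; rewrite !comp_lfunE id_lfunE.
have [w0 w00] := irreducible_neq0 Wj_irr.
have [w|w|a w x w' x'|g w x|phi [phihom phiE]] := hom_of_graph
    (R := fun w x => th (ext_inj E w) = ext_inj E' x).
- by have /ext_proj_eq0[x ->] := pti w; exists x.
- by rewrite !linear0 => /esym/ext_inj_eq0.
- by move=> h h'; rewrite !linearP /= h h'.
- by move=> h; rewrite !ext_inj_hom thhom h.
have {}phiE w : th (ext_inj E w) = ext_inj E' (phi w).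
  by have /ext_proj_eq0[x xE] := pti w; rewrite xE (phiE w x).
have phiiso : is_rep_iso phi.
  apply: irreducible_hom_iso => //; exists w0 => phi0; apply: w00.
  apply: (@ext_inj_eq0 E); apply: (bij_inj thbij).
  by rewrite phiE phi0 !linear0.
have [phi' [_ _ phiK]] := iso_inv phiiso.
have [w|w|a w x w' x'|g w x|psi [psihom psiE]] := hom_of_graph
    (R := fun w x => exists e, w = ext_proj E' (th e) /\ x = ext_proj E e).
- have [e' <-] := @ext_proj_surj E' w.
  by exists (ext_proj E (th' e')), (th' e'); rewrite th'K.
(* Surjectivity of [phi] is what makes [psi] well defined: if [th e] lies in the copy of [Wj] in
   [E'], then [e] lies in the one in [E]. *)
- move=> [e [/esym/ext_proj_eq0[x ex] ->]].
  rewrite -(phiK x) -phiE in ex; move/(bij_inj thbij) : ex => ->.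
  exact: ext_projK.
- by move=> [e [-> ->]] [e' [-> ->]]; exists (a *: e + e'); rewrite !linearP.
- move=> [e [-> ->]]; exists (rep_act E g e).
  by rewrite thhom !ext_proj_hom.
exists th, phi, psi; split=> //.
- apply: irreducible_hom_iso => //.
  have [w1 w10] := irreducible_neq0 Wi_irr; have [e eE] := @ext_proj_surj E w1.
  by exists (ext_proj E' (th e)); rewrite (psiE _ w1) //; exists e.
- by apply/lfunP => w; rewrite !comp_lfunE phiE.
- by apply/lfunP => e; rewrite !comp_lfunE (psiE _ (ext_proj E e)) //; exists e.
Qed.

End Extensions.

(** * Subquotients of a representation over K *)

Lemma int_threshold (P : int -> Prop) (a b : nat) :
  P (- a%:Z) -> ~ P b%:Z -> exists n, P (n - 1) /\ ~ P n.
Proof.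
move=> Pa nPb; apply: contrapT => /forallNP noP; apply: nPb.
have {}noP n : P (n - 1) -> P n.
  by move=> Pn1; apply: contrapT => nPn; apply: (noP n).
have Pm m : P (- a%:Z + m%:Z).
  elim: m => [|m IH]; rewrite ?addr0 //; apply: noP.
  by rewrite -addrA -addn1 PoszD addrK.
by have := Pm (a + b)%N; rewrite PoszD addKr.
Qed.

Lemma nat_threshold (P : nat -> Prop) (N : nat) :
  P 0%N -> ~ P N -> exists k : 'I_N, P k /\ ~ P k.+1.
Proof.
elim: N => // N IH P0 nPN.
have [PN|nP] := pselect (P N); first by exists ord_max.
have [k Pk] := IH P0 nP; exists (widen_ord (leqnSn N) k); exact: Pk.
Qed.

Section Subquotients.
Variables (K : completeDVFieldType) (pi : K) (F : fieldType).
Variable res : {rmorphism integers K -> F}.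
Hypotheses (hpi : uniformiser pi) (hres : is_residue_map res).
Variables (G : topologicalGroupType) (rho : rep K G) (L : set rho).
Implicit Types X Y : rep F G.

Lemma integer_pi : pi \in integer_pred (K := K).
Proof. by rewrite unfold_in hpi. Qed.

Definition piO : integers K := Integer integer_pi.

Lemma res_pi : res piO = 0.
Proof. by apply/hres.2; rewrite /= hpi. Qed.

Lemma pi_neq0 : pi != 0.
Proof. by apply/eqP => /valuation_eqy; rewrite hpi. Qed.

Lemma val_piX n : val (piO ^+ n) = pi ^+ n.
Proof. by rewrite rmorphXn. Qed.

Lemma scale_piz n m (x : rho) : pi ^ n *: (pi ^ m *: x) = pi ^ (n + m) *: x.
Proof. by rewrite scalerA expfzDr // pi_neq0. Qed.

(* A relation R from V to X presents X as the subquotient dom R / ker R of V,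
   for the O_K-submodules dom R = {x | exists y, R x y} and ker R = {x | R x 0};
   the last two fields say that these are commensurable with L. *)
Record subquo X (R : rho -> X -> Prop) : Prop := Subquo {
  subquoD : forall x y x' y', R x y -> R x' y' -> R (x + x') (y + y') ;
  subquoZ : forall (a : integers K) x y, R x y -> R ((a : K) *: x) (res a *: y) ;
  subquoG : forall g x y, R x y -> R (rep_act rho g x) (rep_act X g y) ;
  subquo_fun0 : forall y, R 0 y -> y = 0 ;
  subquo_low : exists n : nat, forall x, L x -> R (pi ^+ n *: x) 0 ;
  subquo_high : exists n : nat, forall x y, R x y -> L (pi ^+ n *: x)
}.

Definition onto X (R : rho -> X -> Prop) := forall y, exists x, R x y.

Section Theory.
Variables (X : rep F G) (R : rho -> X -> Prop).
Hypothesis RP : subquo R.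

Lemma subquo_piX n x : R x 0 -> R (pi ^+ n *: x) 0.
Proof. by move=> /(subquoZ RP (piO ^+ n)); rewrite scaler0 val_piX. Qed.

Lemma subquo_pi x y : R x y -> R (pi *: x) 0.
Proof. by move=> /(subquoZ RP piO); rewrite res_pi scale0r. Qed.

Lemma subquo_piX_dom n x y : R x y -> exists z, R (pi ^+ n *: x) z.
Proof.
move=> /(subquoZ RP (piO ^+ n)); rewrite val_piX => Rx.
by exists (res (piO ^+ n) *: y).
Qed.

Lemma subquoN x y : R x y -> R (- x) (- y).
Proof. by move=> /(subquoZ RP (-1)); rewrite rmorphN rmorph1 !scaleN1r. Qed.

Lemma subquoB x y x' y' : R x y -> R x' y' -> R (x - x') (y - y').
Proof. by move=> Rx /subquoN; exact: subquoD. Qed.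

Lemma subquo_fun x y y' : R x y -> R x y' -> y = y'.
Proof.
move=> Rx /(subquoB Rx); rewrite subrr => /(subquo_fun0 RP)/eqP.
by rewrite subr_eq0 => /eqP.
Qed.

Lemma image_closed a y y' : (exists x, R x y) -> (exists x, R x y') ->
  exists x, R x (a *: y + y').
Proof.
(* Relations are only closed under integral scalars, so a scalar of [F] is lifted through [res]. *)
have [c <-] := hres.1 a.
move=> [x Rx] [x' Rx']; exists ((c : K) *: x + x').
by apply: subquoD => //; exact: subquoZ.
Qed.

Lemma image_act g y : (exists x, R x y) -> exists x, R x (rep_act X g y).
Proof. by move=> [x Rx]; exists (rep_act rho g x); exact: subquoG. Qed.

Lemma irreducible_onto x y : irreducible_rep X -> R x y -> y <> 0 -> onto R.
Proof.
move=> irrX Rxy y0; apply: irreducible_closed y0 => //.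
- exact: image_closed.
- exact: image_act.
- by exists x.
Qed.

Lemma subquo_comp Y (u : 'Hom(X, Y)) : is_rep_hom u ->
  subquo (fun x z => exists y, R x y /\ u y = z).
Proof.
move=> uhom; split.
- move=> x _ x' _ [y [Rx <-]] [y' [Rx' <-]]; exists (y + y').
  by rewrite linearD; split=> //; exact: subquoD.
- move=> a x _ [y [Rx <-]]; exists (res a *: y).
  by rewrite linearZ; split=> //; exact: subquoZ.
- move=> g x _ [y [Rx <-]]; exists (rep_act X g y).
  by rewrite uhom; split=> //; exact: subquoG.
- by move=> _ [y [/(subquo_fun0 RP) -> <-]]; rewrite linear0.
- have [n low] := subquo_low RP; exists n => x /low Rx.
  by exists 0; rewrite linear0.
- have [n high] := subquo_high RP; exists n => x _ [y [Rx _]].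
  exact: high Rx.
Qed.

Lemma subquo_shift n : subquo (fun x y => R (pi ^ n *: x) y).
Proof.
have comm (a : K) x : pi ^ n *: (a *: x) = a *: (pi ^ n *: x).
  by rewrite !scalerA mulrC.
split.
- by move=> x y x' y' Rx Rx'; rewrite scalerDr; exact: subquoD.
- by move=> a x y Rx; rewrite comm; exact: subquoZ.
- by move=> g x y Rx; rewrite -linearZ; exact: subquoG.
- by move=> y; rewrite scaler0; exact: subquo_fun0.
(* [n] may be negative; adding its absolute value leaves the natural exponents [|n| + n] here and
   [|n| - n] for the other bound. *)
- have [a low] := subquo_low RP; exists (a + `|n|)%N => x.
  move=> /low/(subquo_piX (absz (n + absz n))).
  rewrite !exprnP !scale_piz; congr (R (pi ^ _ *: _) _).
  by rewrite PoszD; lia.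
- have [a high] := subquo_high RP; exists (a + `|n|)%N => x y.
  move=> /(subquo_piX_dom (absz (absz n - n)))[z /high].
  rewrite !exprnP !scale_piz; congr (L (pi ^ _ *: _)).
  by rewrite PoszD; lia.
Qed.

End Theory.

(** * Combining two subquotients *)

Section Pairs.
Variables (X Y : rep F G) (R : rho -> X -> Prop) (S : rho -> Y -> Prop).
Hypotheses (RP : subquo R) (SP : subquo S).

Lemma subquo_lowI : exists n : nat, forall x, L x ->
  R (pi ^+ n *: x) 0 /\ S (pi ^+ n *: x) 0.
Proof.
have [n lowR] := subquo_low RP; have [m lowS] := subquo_low SP.
exists (m + n)%N => x Lx; split.
  by rewrite exprD -scalerA; apply: subquo_piX => //; exact: lowR.
by rewrite addnC exprD -scalerA; apply: subquo_piX => //; exact: lowS.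
Qed.

Lemma subquo_restr : subquo (fun x y => R x y /\ exists z, S x z).
Proof.
split.
- move=> x y x' y' [Rx [z Sx]] [Rx' [z' Sx']]; split; first exact: subquoD.
  by exists (z + z'); exact: subquoD.
- move=> a x y [Rx [z Sx]]; split; first exact: subquoZ.
  by exists (res a *: z); exact: subquoZ.
- move=> g x y [Rx [z Sx]]; split; first exact: subquoG.
  by exists (rep_act Y g z); exact: subquoG.
- by move=> y [/(subquo_fun0 RP)].
- have [n low] := subquo_lowI; exists n => x /low[Rx Sx].
  by split=> //; exists 0.
- by have [n high] := subquo_high RP; exists n => x y [/high].
Qed.

(** The part of [ker R] that [S] sends into the copy of [Z] in [Y]. It isolates the occurrences of
    an irreducible inside an extension. *)
Lemma subquo_pull (Z : rep F G) (u : 'Hom(Z, Y)) :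
  is_rep_hom u -> (forall z, u z = 0 -> z = 0) ->
  subquo (fun x z => R x 0 /\ S x (u z)).
Proof.
move=> uhom u0; split.
- move=> x y x' y' [Rx Sx] [Rx' Sx']; rewrite linearD.
  by split; [rewrite -[0]addr0|]; exact: subquoD.
- move=> a x y [Rx Sx]; rewrite linearZ.
  by split; [rewrite -(scaler0 _ (res a))|]; exact: subquoZ.
- move=> g x y [Rx Sx]; rewrite uhom.
  by split; [rewrite -(linear0 (rep_act X g))|]; exact: subquoG.
- by move=> y [_ /(subquo_fun0 SP)/u0].
- have [n low] := subquo_lowI; exists n => x /low[Rx Sx].
  by rewrite linear0.
- by have [n high] := subquo_high RP; exists n => x y [/high].
Qed.

(** [R] is extended by zero to [dom R + pi dom S]; the last hypothesis is what makes this well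
    defined. *)
Lemma subquo_sum :
  (forall x y, L x -> L y -> L (x + y)) ->
  (forall (a : integers K) x, L x -> L ((a : K) *: x)) ->
  (forall x y z, R (pi *: x) y -> S x z -> y = 0) ->
  subquo (fun x y => exists a b z, [/\ x = a + pi *: b, R a y & S b z]).
Proof.
move=> LD LZ RS; split.
- move=> _ y _ y' [a [b [z [-> Ra Sb]]]] [a' [b' [z' [-> Ra' Sb']]]].
  exists (a + a'), (b + b'), (z + z'); split; try exact: subquoD.
  by rewrite scalerDr addrACA.
- move=> c _ y [a [b [z [-> Ra Sb]]]].
  exists ((c : K) *: a), ((c : K) *: b), (res c *: z); split; try exact: subquoZ.
  by rewrite scalerDr !scalerA mulrC.
- move=> g _ y [a [b [z [-> Ra Sb]]]].
  exists (rep_act rho g a), (rep_act rho g b), (rep_act Y g z).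
  by split; try exact: subquoG; rewrite linearD linearZ.
- move=> y [a [b [z [/esym/eqP]]]]; rewrite addrC addr_eq0 => /eqP aE Ra Sb.
  apply/eqP; rewrite -oppr_eq0; apply/eqP; apply: (RS b _ z) => //.
  by rewrite aE; exact: subquoN.
- have [n low] := subquo_lowI; exists n => x /low[Rx Sx].
  exists (pi ^+ n *: x), 0, 0; split=> //; first by rewrite scaler0 addr0.
  by have := subquoB SP Sx Sx; rewrite !subrr.
- have [n highR] := subquo_high RP; have [m highS] := subquo_high SP.
  exists (n + m)%N => _ y [a [b [z [-> /highR La /highS Lb]]]].
  rewrite scalerDr; apply: LD.
    by rewrite addnC exprD -scalerA -val_piX; exact: LZ.
  rewrite exprD scalerA -mulrA [_ * pi]mulrC mulrA -exprSr -scalerA -val_piX.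
  exact: LZ.
Qed.

End Pairs.

(** * Jumps along a chain from [pi L] to [L] *)

Section Chain.
Variables (C : nat -> set rho) (N : nat) (gr : 'I_N -> rep F G).
Variable T : forall k, rho -> gr k -> Prop.
Hypotheses (gr_irr : forall k, irreducible_rep (gr k))
  (TP : forall k, subquo (@T k))
  (T_dom : forall (k : 'I_N) x, C k.+1 x <-> exists y, @T k x y)
  (T_ker : forall (k : 'I_N) x, C k x <-> @T k x 0)
  (C0 : forall x, C 0%N x <-> L (pi^-1 *: x))
  (CN : C N = L).

Definition jump k n (B : rho -> Prop) :=
  exists x, [/\ B x, C k.+1 (pi ^ n *: x) & ~ C k (pi ^ n *: x)].

(** The lattices [pi^-n C_k] form an increasing filtration, and [(k, n)] marks the step at which its
    intersection with [dom R] first has nonzero image in [W]. That step identifies [gr k] with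
    [W]. *)
Lemma subquo_jump (W : rep F G) (R : rho -> W -> Prop) :
  irreducible_rep W -> subquo R -> onto R ->
  exists (k : 'I_N) n, [/\ rep_isom W (gr k), jump k n (fun x => exists y, R x y)
    & ~ jump k n (fun x => R x 0)].
Proof.
move=> irrW RP Ronto; have [w w0] := irreducible_neq0 irrW.
have [xw Rxw] := Ronto w.
have [n [Pn nPn]] : exists n,
    (forall x y, R x y -> L (pi ^ (n - 1) *: x) -> y = 0) /\
    ~ (forall x y, R x y -> L (pi ^ n *: x) -> y = 0).
  have [a low] := subquo_low RP; have [b high] := subquo_high RP.
  apply: (int_threshold (P := fun n =>
    forall x y, R x y -> L (pi ^ n *: x) -> y = 0) (a := a) (b := b)).
    move=> x y Rx /low; rewrite exprnP scale_piz subrr expr0z scale1r.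
    exact: subquo_fun.
  by move=> Pb; apply: w0; apply: Pb (Rxw) _; rewrite -exprnP; exact: high Rxw.
(* As [C 0] is [pi L], the bottom of the chain at level [n] is its top at level [n - 1], where the
   image in [W] is still zero. *)
have [k [Qk nQk]] : exists k : 'I_N,
    (forall x y, R x y -> C k (pi ^ n *: x) -> y = 0) /\
    ~ (forall x y, R x y -> C k.+1 (pi ^ n *: x) -> y = 0).
  apply: (nat_threshold (P := fun k =>
    forall x y, R x y -> C k (pi ^ n *: x) -> y = 0)); last by rewrite CN.
  move=> x y Rx /C0; rewrite -exprN1 scale_piz addrC; exact: Pn.
exists k, n.
have [x1 [y1 [Rx1 Cx1 y10]]] : exists x y, [/\ R x y, C k.+1 (pi ^ n *: x) & y <> 0].
  apply: contrapT => H; apply: nQk => x y Rx Cx; apply: contrapT => y0.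
  by apply: H; exists x, y.
have nCx1 : ~ C k (pi ^ n *: x1) by move=> Cx; apply: y10; exact: Qk Rx1 Cx.
have [t1 Tx1] := (T_dom _ _).1 Cx1.
have t10 : t1 <> 0 by move=> t10; apply: nCx1; apply/T_ker; rewrite -t10.
have Sonto := irreducible_onto (subquo_restr (subquo_shift (TP k) n) RP)
  (gr_irr k) (conj Tx1 (ex_intro _ _ Rx1)) t10.
(* Elements of [dom R] lying in [pi^-n C_k] die in [W], so the class in [gr k] determines the image
   in [W]. Injectivity of the resulting [u] shows that [ker R] lacks the jump. *)
have [t|y|a t y t' y'|g t y|u [uhom uE]] := hom_of_graph
    (R := fun t y => exists x, @T k (pi ^ n *: x) t /\ R x y).
- by have [x [Tx [y Rx]]] := Sonto t; exists y, x.
- by move=> [x [/T_ker Tx Rx]]; exact: Qk Rx Tx.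
- have [c <-] := hres.1 a.
  move=> [x [Tx Rx]] [x' [Tx' Rx']]; exists ((c : K) *: x + x'); split.
    apply: (subquoD (subquo_shift (TP k) n)) => //.
    exact: (subquoZ (subquo_shift (TP k) n)).
  by apply: subquoD => //; exact: subquoZ.
- move=> [x [Tx Rx]]; exists (rep_act rho g x); split; last exact: subquoG.
  exact: (subquoG (subquo_shift (TP k) n)).
have uiso : is_rep_iso u.
  apply: irreducible_hom_iso => //; exists t1.
  by rewrite (uE _ y1) //; exists x1.
split; first by apply: rep_isom_sym; exists u.
- by exists x1; split=> //; exists y1.
- move=> [x [Rx /T_dom[t Tx]]]; apply; apply/T_ker.
  suff -> : 0 = t by [].
  apply: (bij_inj uiso.2); rewrite linear0 (uE t 0) //; exists x.
  by split.
Qed.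

(** The inclusions [pi dom S <= ker R <= dom R <= ker S <= dom S] would put [W] twice in
    [dom S / pi dom S]. Both copies yield jumps at the same [k], at levels [n] and [m]. If [m <= n],
    scaling the first witness gives [ker S] the jump it lacks; if [n < m], scaling the second does
    so for [ker R]. *)
Lemma mult_one_chain (W : rep F G) (R S : rho -> W -> Prop) :
  irreducible_rep W ->
  (forall k l, rep_isom W (gr k) -> rep_isom W (gr l) -> k = l) ->
  subquo R -> onto R -> subquo S -> onto S ->
  (forall x y, R x y -> S x 0) -> (forall x y, S x y -> R (pi *: x) 0) -> False.
Proof.
move=> irrW uniqk RP Ronto SP Sonto RS SR.
have [k [n [Wk [x [[y Rx] Cx nCx]] nR]]] := subquo_jump irrW RP Ronto.
have [l [m [Wl [x' [[y' Sx'] Cx' nCx']] nS]]] := subquo_jump irrW SP Sonto.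
have kl := uniqk _ _ Wk Wl; subst l.
have [mn|nm] := leP m n.
  apply: nS; exists (pi ^+ (absz (n - m)%R) *: x); split.
  - by apply: subquo_piX => //; exact: RS Rx.
  - by rewrite exprnP scale_piz (_ : m + _ = n) //; lia.
  - by rewrite exprnP scale_piz (_ : m + _ = n) //; lia.
(* One factor [pi] of [pi^(m - n)] is kept apart, to pass from [dom S] to [ker R]. *)
apply: nR; exists (pi *: (pi ^+ (absz (m - n - 1)%R) *: x')).
have E : pi ^ n *: (pi *: (pi ^+ (absz (m - n - 1)%R) *: x')) = pi ^ m *: x'.
  by rewrite exprnP -{2}(expr1z pi) !scale_piz; congr (pi ^ _ *: _); lia.
split; rewrite ?E //.
by have [z Sz] := subquo_piX_dom SP (absz (m - n - 1)%R) Sx'; exact: SR Sz.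
Qed.

End Chain.
End Subquotients.

(** * Lattices and their reductions *)

Section Lattices.
Variables (K : completeDVFieldType) (pi : K).
Hypothesis hpi : uniformiser pi.

Lemma valuation_piX n : valuation (pi ^+ n) = n%:Z%:E.
Proof.
elim: n => [|n IH]; first by rewrite expr0 valuation1.
by rewrite exprS valuationM hpi IH -EFinD -PoszD add1n.
Qed.

Lemma integer_piX_mul (x : K) :
  exists n : nat, pi ^+ n * x \in integer_pred (K := K).
Proof.
case vx : (valuation x) => [r| |].
- exists `|r|%N; rewrite unfold_in valuationM valuation_piX vx -EFinD lee_fin; lia.
- by exists 0%N; rewrite expr0 mul1r unfold_in vx.
(* The value [-oo] is impossible: no extended integer added to it gives 0, the valuation of
   [x * x^-1]. *)
- have x0 : x != 0 by apply/eqP => /valuation_eqy; rewrite vx.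
  have := valuationM x x^-1; rewrite mulfV // valuation1 vx.
  by case: (valuation x^-1).
Qed.

Lemma integer_piX_mul_fin (I : finType) (d : I -> K) :
  exists n : nat, forall i, pi ^+ n * d i \in integer_pred (K := K).
Proof.
have [n nP] := choice (fun i => integer_piX_mul (d i)).
exists (\max_i n i)%N => i; rewrite -(subnK (leq_bigmax i)) exprD -mulrA.
by rewrite rpredM // rpredX // integer_pi.
Qed.

Variables (G : topologicalGroupType) (rho : rep K G).
Implicit Types L : set rho.

Lemma latticeD L x y : lattice L -> L x -> L y -> L (x + y).
Proof.
move=> [e [_ ->]] [c ->] [d ->]; exists (fun k => c k + d k).
by rewrite -big_split /=; apply: eq_bigr => k _; rewrite -scalerDl.
Qed.

Lemma latticeZ L (a : integers K) x : lattice L -> L x -> L ((a : K) *: x).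
Proof.
move=> [e [_ ->]] [c ->]; exists (fun k => a * c k).
by rewrite scaler_sumr; apply: eq_bigr => k _; rewrite scalerA.
Qed.

Lemma lattice0 L : lattice L -> L 0.
Proof.
move=> [e [_ ->]]; exists (fun _ => 0).
by rewrite big1 // => k _; rewrite scale0r.
Qed.

(** Clearing denominators in a linear relation shows that an integral basis of [L'] is a basis over
    [K]; a power of [pi] then clears the denominators of the coordinates of a basis of [L]. *)
Lemma lattice_commensurable L L' : lattice L -> lattice L' ->
  exists n : nat, forall x, L x -> L' (pi ^+ n *: x).
Proof.
move=> [e [_ ->]] latL'; have [e' [e'_free L'E]] := latL'.
pose X := [tuple e' k | k < \dim {:rho}].
have XE (k : 'I_(\dim {:rho})) : X`_k = e' k by rewrite -tnth_nth tnth_mktuple.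
have basisX : basis_of fullv X.
  rewrite basisEfree subvf size_tuple leqnn !andbT; apply/freeP => c c0 k.
  have [n nP] := integer_piX_mul_fin c.
  have := e'_free (fun k => Integer (nP k)) _ k => /(_ _)/(congr1 val)/=.
  have -> : \sum_k (pi ^+ n * c k) *: e' k = 0.
    transitivity (pi ^+ n *: \sum_(i < \dim {:rho}) c i *: X`_i).
      by rewrite scaler_sumr; apply: eq_bigr => i _; rewrite scalerA XE.
    by rewrite c0 scaler0.
  move=> /(_ erefl)/eqP; rewrite mulf_eq0 expf_eq0 (negPf (pi_neq0 hpi)) andbF.
  by move/eqP.
have [n nP] := integer_piX_mul_fin (fun kl : 'I_(\dim {:rho}) * 'I_(\dim {:rho}) =>
  coord X kl.2 (e kl.1)).
exists n => _ [c ->]; rewrite scaler_sumr.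
elim/big_ind: _; [exact: lattice0 | by move=> x y; exact: latticeD |].
move=> k _; rewrite scalerA mulrC -scalerA; apply: latticeZ => //.
rewrite (coord_basis basisX (memvf (e k))) L'E.
exists (fun l => Integer (nP (k, l))); rewrite scaler_sumr.
by apply: eq_bigr => l _; rewrite scalerA XE.
Qed.

End Lattices.

(** * Realised extensions as subquotients *)

Section Realisation.
Variables (K : completeDVFieldType) (pi : K) (F : fieldType).
Variable res : {rmorphism integers K -> F}.
Hypotheses (hpi : uniformiser pi) (hres : is_residue_map res).
Variables (G : topologicalGroupType) (rho : rep K G).

Lemma reduction_subquo (L0 L : set rho) (M Q : rep F G) (red : rho -> M)
    (U : {vspace M}) (p : 'Hom(M, Q)) :
  lattice L0 -> stable_lattice L ->
  (forall x y, L x -> L y -> red (x + y) = red x + red y) ->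
  (forall (a : integers K) x, L x -> red ((a : K) *: x) = res a *: red x) ->
  (forall g x, L x -> red (rep_act rho g x) = rep_act M g (red x)) ->
  subrep U ->
  (forall g x, x \in U -> p (rep_act M g x) = rep_act Q g (p x)) ->
  subquo pi res L0 (fun x y => [/\ L x, red x \in U & p (red x) = y]).
Proof.
move=> latL0 [latL Lg] redD redZ redG Ug pG.
have L00 := lattice0 latL.
split.
- move=> x _ x' _ [Lx xU <-] [Lx' xU' <-]; rewrite redD // linearD memvD //.
  by split=> //; exact: latticeD.
- move=> a x _ [Lx xU <-]; rewrite redZ // linearZ memvZ //.
  by split=> //; exact: latticeZ.
- move=> g x _ [Lx xU <-]; rewrite redG // pG //; split=> //.
    by rewrite -(Lg g); exists x.
  by apply: (subvP (Ug g)); exact: memv_img.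
- move=> _ [_ _ <-]; rewrite -[0 : rho](scale0r (0 : rho)).
  by rewrite (redZ 0) // rmorph0 scale0r linear0.
- have [n nP] := lattice_commensurable hpi latL0 latL.
  (* [pi^n x] is in [L]; one more factor [pi] makes its reduction vanish. *)
  exists n.+1 => x /nP Lx; rewrite exprS -scalerA.
  rewrite (redZ (piO hpi)) // res_pi // scale0r mem0v linear0; split=> //.
  exact: (latticeZ (piO hpi)).
- have [n nP] := lattice_commensurable hpi latL latL0.
  by exists n => x y [/nP].
Qed.

(** Only the middle term of the extension is kept; [equivalent_of_isom] later recovers the maps at
    both ends. *)
Lemma realises_subquo (L0 : set rho) (Wi Wj : rep F G) (E : extension Wi Wj) :
  lattice L0 -> realises rho pi res E ->
  exists R : rho -> E -> Prop, subquo pi res L0 R /\ onto R.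
Proof.
move=> latL0 [L [M [U0 [U1 [latL [red [[redD redZ] redS _ redG]] [_ U1g _]
  [E' [p [pG pS _]] [th [[thhom [th' thK th'K]] _ _]]]]]]]].
have RP := subquo_comp (reduction_subquo latL0 latL redD redZ redG U1g pG) thhom.
eexists; split; first exact: RP.
move=> y; have : th' y \in (p @: U1)%VS by rewrite pS memvf.
move=> /memv_imgP[z zU zE]; have [x Lx xz] := redS z; exists x, (th' y).
by split=> //; split; rewrite ?xz.
Qed.

(** A composition series of the reduction pulls back to a chain from [pi L] to [L]. By
    [multiplicity_one] only one of its factors is isomorphic to [W i], so [mult_one_chain]
    applies. *)
Lemma residual_mult_one (r : nat) (W : 'I_r -> rep F G) (m : 'I_r -> nat) :
  (forall i, irreducible_rep (W i)) ->
  (forall i j, i <> j -> ~ rep_isom (W i) (W j)) ->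
  is_residual_ss rho pi res (rep_bigsum (fun i => rep_mul (W i) (m i))) ->
  exists L0 : set rho, lattice L0 /\
    forall (i : 'I_r) (R S : rho -> W i -> Prop), m i = 1%N ->
      subquo pi res L0 R -> onto R -> subquo pi res L0 S -> onto S ->
      (forall x y, R x y -> S x 0) -> (forall x y, S x y -> R (pi *: x) 0) ->
      False.
Proof.
move=> Wirr Wniso [L [M [stL [red [[redD redZ] redS redK redG]]
  [n [fil [gr [[fil0 filn] filG filS filQ Sgr]]]]]]].
have latL : lattice L by case: stL.
exists L; split=> // i R S mi RP Ronto SP Sonto RS SR.
pose p (k : 'I_n) := projT1 (cid (filQ k).1).
have pP (k : 'I_n) := projT2 (cid (filQ k).1); rewrite -/(p _) in pP.
pose C k : set rho := [set x | L x /\ red x \in fil k].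
pose T (k : 'I_n) x y := [/\ L x, red x \in fil k.+1 & p k (red x) = y].
have TP k : subquo pi res L (T k).
  have [pG _ _] := pP k.
  by apply: reduction_subquo redG _ pG => //; exact: filG.
apply: (@mult_one_chain _ pi _ res hpi hres _ rho L C n gr T _ TP
  _ _ _ _ (W i) R S) => //.
- by move=> k; exact: (filQ k).2.
- move=> k x; split; first by move=> [Lx xk]; exists (p k (red x)).
  by move=> [y []].
- move=> k x; have [_ _ kerE] := pP k; split.
    move=> [Lx]; rewrite -kerE => /memv_capP[xk].
    by rewrite memv_ker => /eqP.
  move=> [Lx xk px]; split=> //; rewrite -kerE; apply/memv_capP.
  by rewrite memv_ker px.
- move=> x; rewrite /C /= fil0; split.
    move=> [Lx]; rewrite memv0 => /eqP/(redK _ Lx)[y Ly ->].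
    by rewrite scalerA mulVf ?pi_neq0 // scale1r.
  move=> Ly; have xE : x = pi *: (pi^-1 *: x).
    by rewrite scalerA mulfV ?pi_neq0 // scale1r.
  have Lx : L x by rewrite xE; exact: (latticeZ (piO hpi)).
  by split=> //; rewrite memv0; apply/eqP/redK => //; exists (pi^-1 *: x).
- apply/seteqP; split => [x []//|x Lx].
  by split=> //; rewrite filn memvf.
- by move=> k l; exact: (multiplicity_one Wirr Wniso mi Sgr).
Qed.

Section Comparison.
Variables (L : set rho) (Wi Wj : rep F G) (E E' : extension Wi Wj).
Hypotheses (latL : lattice L)
  (Wi_irr : irreducible_rep Wi) (Wj_irr : irreducible_rep Wj)
  (E_nonsplit : ~ split_extension E) (E'_nonsplit : ~ split_extension E').

Lemma common_domain (R : rho -> E -> Prop) (R' : rho -> E' -> Prop) :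
  (forall A B : rho -> Wi -> Prop,
     subquo pi res L A -> onto A -> subquo pi res L B -> onto B ->
     (forall x y, A x y -> B x 0) -> (forall x y, B x y -> A (pi *: x) 0) ->
     False) ->
  subquo pi res L R -> onto R -> subquo pi res L R' -> onto R' ->
  exists (S : rho -> E -> Prop) (S' : rho -> E' -> Prop),
    [/\ subquo pi res L S, onto S, subquo pi res L S', onto S'
      & forall x, (exists e, S x e) <-> exists e', S' x e'].
Proof.
move=> mult1 RP Ronto R'P R'onto.
have [w0 w00] := irreducible_neq0 Wi_irr.
(* This scales the second lattice: with [R''] the shift of [R'] by [n], the intersection of [dom R]
   with [dom R''] reaches [Wi] through [E], but that with [pi dom R''] does not. *)
have [n [Pn nPn]] : exists n,
    (forall x e e', R x e -> R' (pi ^ (n - 1) *: x) e' -> ext_proj E e = 0) /\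
    ~ (forall x e e', R x e -> R' (pi ^ n *: x) e' -> ext_proj E e = 0).
  have [l low] := subquo_low RP; have [h high] := subquo_high RP.
  have [l' low'] := subquo_low R'P; have [h' high'] := subquo_high R'P.
  apply: (int_threshold (P := fun n => forall x e e',
    R x e -> R' (pi ^ n *: x) e' -> ext_proj E e = 0) (a := l + h') (b := l' + h)).
    move=> x e e' Rx /high'/low; rewrite !exprnP !scale_piz // -PoszD subrr.
    by rewrite expr0z scale1r => /(subquo_fun RP Rx) ->; rewrite linear0.
  move=> Pb; apply: w00; have [e <-] := ext_proj_surj E w0.
  have [x Rx] := Ronto e; apply: (Pb x e 0) => //.
  by rewrite -exprnP exprD -scalerA; apply: low'; exact: high Rx.
have R''P := subquo_shift hpi R'P n; set R'' := fun _ => _ in R''P.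
have R''onto : onto R''.
  move=> e'; have [x Rx] := R'onto e'; exists (pi ^ (- n) *: x).
  by rewrite /R'' scale_piz // subrr expr0z scale1r.
have R''00 : R'' 0 0.
  have [x Rx] := R''onto 0.
  by have := subquoB R''P Rx Rx; rewrite !subrr.
have R00 : R 0 0.
  by have [x Rx] := Ronto 0; have := subquoB RP Rx Rx; rewrite !subrr.
have [x0 [e0 [e0' [Rx0 R''x0 pe0]]]] :
    exists x e e', [/\ R x e, R'' x e' & ext_proj E e <> 0].
  apply: contrapT => H; apply: nPn => x e e' Rx R'x; apply: contrapT => pe.
  by apply: H; exists x, e, e'.
have SP := subquo_restr hpi RP R''P; have S'P := subquo_restr hpi R''P RP.
do 2 eexists; split; [exact: SP | | exact: S'P | |].
- apply: (nonsplit_cosocle Wi_irr Wj_irr E_nonsplit _ _ _ pe0).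
  + by move=> a y y'; exact: image_closed SP a y y'.
  + by move=> g y; exact: image_act SP g y.
  + by exists x0; split=> //; exists e0'.
- have [[x1 [e1 [e1' [Rx1 R''x1 pe1]]]]|noM] := pselect (exists x e e',
      [/\ R x e, R'' x e' & ext_proj E' e' <> 0]).
    apply: (nonsplit_cosocle Wi_irr Wj_irr E'_nonsplit _ _ _ pe1).
    + by move=> a y y'; exact: image_closed S'P a y y'.
    + by move=> g y; exact: image_act S'P g y.
    + by exists x1; split=> //; exists e1.
  (* If the intersection dies in [Wi] through [E'], then [Wi] occurs twice in
     [dom R'' / pi dom R'']: at the top through [E'], and below it through [E], on the intersection
     enlarged by [pi dom R'']. *)
  exfalso.
  have AP := subquo_comp SP (@ext_proj_hom _ _ _ _ E).
  have BP := subquo_comp R''P (@ext_proj_hom _ _ _ _ E').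
  have RR'' x w z : (exists e, (R (pi *: x) e /\ exists e', R'' (pi *: x) e') /\
      ext_proj E e = w) -> R'' x z -> w = 0.
    move=> [e [[Rx _] <-]] R''x; apply: (Pn _ _ z Rx).
    by rewrite -{2}(expr1z pi) scale_piz // subrK.
  have DP := subquo_sum hpi AP R''P (fun _ _ => latticeD latL)
    (fun a _ => latticeZ a latL) RR''.
  apply: (mult1 _ _ DP _ BP).
  + apply: (irreducible_onto hres DP (x := x0) Wi_irr _ pe0).
    exists x0, 0, 0; split=> //; first by rewrite scaler0 addr0.
    by exists e0; split=> //; split=> //; exists e0'.
  + move=> w; have [e' <-] := ext_proj_surj E' w; have [x R''x] := R''onto e'.
    by exists x, e'.
  + move=> _ y [a [b [z [-> [e [[Ra [e' R''a]] _]] R''b]]]].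
    exists (e' + 0); split.
      by apply: (subquoD R''P) => //; exact: (subquo_pi hpi hres R''P R''b).
    rewrite addr0; apply: contrapT => pe'; apply: noM.
    by exists a, e, e'.
  + move=> x y [e' [R''x _]]; exists 0, x, e'; split; rewrite ?add0r //.
    by exists 0; rewrite linear0; split=> //; split=> //; exists 0.
- move=> x; split.
    by move=> [e [Rx [e' R'x]]]; exists e'; split=> //; exists e.
  by move=> [e' [R'x [e Rx]]]; exists e; split=> //; exists e'.
Qed.

End Comparison.

(** Otherwise the image of [ker R] in [E'] is nonzero, hence contains [Wj] by [nonsplit_socle]. So
    [Wj] occurs below [ker R] through [E'] and just above it through [E], twice in the reduction of
    the common domain. *)
Lemma subquo_ker_sub (L : set rho) (Wi Wj : rep F G) (E E' : extension Wi Wj)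
    (R : rho -> E -> Prop) (R' : rho -> E' -> Prop) :
  irreducible_rep Wi -> irreducible_rep Wj -> ~ split_extension E' ->
  (forall A B : rho -> Wj -> Prop,
     subquo pi res L A -> onto A -> subquo pi res L B -> onto B ->
     (forall x y, A x y -> B x 0) -> (forall x y, B x y -> A (pi *: x) 0) ->
     False) ->
  subquo pi res L R -> onto R -> subquo pi res L R' ->
  (forall x, (exists e, R x e) <-> exists e', R' x e') ->
  forall x, R x 0 -> R' x 0.
Proof.
move=> Wi_irr Wj_irr E'_nonsplit mult1 RP Ronto R'P domE x Rx.
have [e' R'x] : exists e', R' x e' by apply/domE; exists 0.
have [<-//|/eqP e'0] := eqVneq e' 0.
have id_hom : is_rep_hom (\1%VF : 'Hom(E', E')).
  by move=> g y; rewrite !id_lfunE.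
have id0 (y : E') : \1%VF y = 0 -> y = 0 by rewrite id_lfunE.
have TP := subquo_pull hpi RP R'P id_hom id0.
have AP := subquo_pull hpi RP R'P
  (@ext_inj_hom _ _ _ _ E') (@ext_inj_eq0 _ _ _ _ E').
(* [B] is the preimage under [R] of the copy of [Wj] in [E]; the condition through [ext_proj] holds
   automatically there. *)
have BP := subquo_pull hpi (subquo_comp RP (@ext_proj_hom _ _ _ _ E)) RP
  (@ext_inj_hom _ _ _ _ E) (@ext_inj_eq0 _ _ _ _ E).
have [||| w [w0 [x1 [Rx1]]]] := nonsplit_socle Wi_irr E'_nonsplit
    (T := fun y => exists x, R x 0 /\ R' x (\1%VF y)) _ _ _ e'0.
- by move=> a y y'; exact: image_closed TP a y y'.
- by move=> g y; exact: image_act TP g y.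
- by exists x; rewrite id_lfunE.
rewrite id_lfunE => R'x1; exfalso; apply: (mult1 _ _ AP _ BP).
- exact: (irreducible_onto hres AP Wj_irr (conj Rx1 R'x1) w0).
- move=> v; have [y Ry] := Ronto (ext_inj E v); exists y; split=> //.
  by exists (ext_inj E v); rewrite ext_projK.
- move=> y v [Ry _]; rewrite linear0; split=> //.
  by exists 0; rewrite linear0.
- move=> y v [_ Ry]; rewrite linear0; split; first exact: (subquo_pi hpi hres RP Ry).
  have [z R'y] : exists z, R' y z by apply/domE; exists (ext_inj E v).
  exact: (subquo_pi hpi hres R'P R'y).
Qed.

Lemma subquo_isom (L : set rho) (X Y : rep F G)
    (R : rho -> X -> Prop) (S : rho -> Y -> Prop) :
  subquo pi res L R -> onto R -> subquo pi res L S -> onto S ->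
  (forall x, (exists y, R x y) <-> exists z, S x z) ->
  (forall x, R x 0 <-> S x 0) -> rep_isom X Y.
Proof.
move=> RP Ronto SP Sonto domE kerE.
have [y|z|a y z y' z'|g y z|u [uhom uE]] := hom_of_graph
    (R := fun y z => exists x, R x y /\ S x z).
- have [x Rx] := Ronto y.
  by have [z Sx] : exists z, S x z; [apply/domE; exists y | exists z, x].
- by move=> [x [/kerE Sx0 Sx]]; exact: (subquo_fun SP Sx Sx0).
- have [c <-] := hres.1 a.
  move=> [x [Rx Sx]] [x' [Rx' Sx']]; exists ((c : K) *: x + x').
  by split; [apply: (subquoD RP); first exact: (subquoZ RP)
            |apply: (subquoD SP); first exact: (subquoZ SP)].
- move=> [x [Rx Sx]]; exists (rep_act rho g x).
  by split; [exact: (subquoG RP) | exact: (subquoG SP)].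
exists u; split=> //; apply: bijective_lfun => [y uy|z].
  have [x Rx] := Ronto y.
  have [z Sx] : exists z, S x z by apply/domE; exists y.
  have z0 : z = 0 by rewrite -uy; symmetry; apply: uE; exists x.
  by apply: (subquo_fun RP Rx); apply/kerE; rewrite -z0.
have [x Sx] := Sonto z.
have [y Rx] : exists y, R x y by apply/domE; exists z.
by exists y; apply: uE; exists x.
Qed.

End Realisation.

Theorem theorem1p4
  (K : completeDVFieldType) (pi : K) (hpi : uniformiser pi)
  (F : fieldType) (res : {rmorphism integers K -> F})
  (hres : is_residue_map res)
  (G : topologicalGroupType) (hG : compact [set: G])
  (rho : rep K G) (rho_cont : continuous_rep rho)
  (rho_irr : irreducible_rep rho)
  (r : nat) (W : 'I_r -> rep F G) (m : 'I_r -> nat)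
  (W_irr : forall i, irreducible_rep (W i))
  (W_noniso : forall i j, i <> j -> ~ rep_isom (W i) (W j))
  (hss : is_residual_ss rho pi res (rep_bigsum (fun i => rep_mul (W i) (m i))))
  (i j : 'I_r) (hmi : m i = 1%N) (hmj : m j = 1%N)
  (E E' : extension (W i) (W j))
  (E_nonsplit : ~ split_extension E) (E'_nonsplit : ~ split_extension E')
  (E_real : realises rho pi res E) (E'_real : realises rho pi res E') :
  equivalent_extensions E E'.
Proof.
have [L [latL mult1]] := residual_mult_one hpi hres W_irr W_noniso hss.
have [R [RP Ronto]] := realises_subquo hpi hres latL E_real.
have [R' [R'P R'onto]] := realises_subquo hpi hres latL E'_real.
have [S [S' [SP Sonto S'P S'onto domE]]] :=
  common_domain hpi hres latL (W_irr i) (W_irr j) E_nonsplit E'_nonsplit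
    (fun A B => mult1 i A B hmi) RP Ronto R'P R'onto.
apply: (equivalent_of_isom (W_irr i) (W_irr j) E'_nonsplit).
(* The domains agree, so it remains to compare the kernels; the two inclusions are symmetric in [E]
   and [E']. *)
apply: (subquo_isom hres SP Sonto S'P S'onto domE) => x; split.
  exact: (subquo_ker_sub hpi hres (W_irr i) (W_irr j) E'_nonsplit
    (fun A B => mult1 j A B hmj) SP Sonto S'P domE).
exact: (subquo_ker_sub hpi hres (W_irr i) (W_irr j) E_nonsplit
  (fun A B => mult1 j A B hmj) S'P S'onto SP (fun y => iff_sym (domE y))).
Qed.
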